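(* Let $X$ be a compact metric space with metric $d$, let $f\colon X\to X$ be a continuous map and let $x\in X$. If $f$ is equicontinuous at $x$ and if $x\in\overline{\mathbb{A}(f)}$ (the closure of $\mathbb{A}(f)$ in $X$), then $x\in\mathbb{A}(f)$.
   Context: Let $X$ be a compact metric space with metric $d$ and $f\colon X\to X$ a continuous map. The map $f$ is equicontinuous at $x\in X$ if for every $\epsilon>0$ there is $\delta>0$ such that for all $y\in X$, $d(x,y)\le\delta$ implies $\sup_{i\ge0}d(f^i(x),f^i(y))\le\epsilon$. A subset $S\subset X$ is $f$-invariant if $f(S)\subset S$. For $x\in X$, the $\omega$-limit set $\omega(x,f)$ is the set of $y\in X$ such that $\lim_{j\to\infty}f^{i_j}(x)=y$ for some sequence of integers $0\le i_1<i_2<\cdots$. Odometers: given a nondecreasing sequence $m=(m_j)_{j\ge1}$ of positive integers with $m_j\mid m_{j+1}$ for all $j\ge1$ and $\lim_{j\to\infty}m_j=\infty$, let $X(j)=\{0,1,\dots,m_j-1\}$ with the discrete topology, let \[ X_m=\Big\{(x_j)_{j\ge1}\in\prod_{j\ge1}X(j)\colon x_j\equiv x_{j+1}\pmod{m_j}\text{ for all }j\ge1\Big\} \] with the subspace topology from the product space, and define $g_m\colon X_m\to X_m$ by $g_m(x)_j=x_j+1\pmod{m_j}$ for all $x=(x_j)_{j\ge1}\in X_m$ and $j\ge1$. The homeomorphism $g_m$ is called an odometer with periodic structure $m$. A closed $f$-invariant subset $S$ of $X$ is called an odometer if $f|_S\colon S\to S$ is topologically conjugate to such a map, i.e. there are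 some such $g_m\colon X_m\to X_m$ and a homeomorphism $h\colon X_m\to S$ with $f|_S\circ h=h\circ g_m$. A closed $f$-invariant subset $S$ of $X$ is a periodic orbit if there are $x\in S$ and $i>0$ such that $f^i(x)=x$ and $S=\{x,f(x),\dots,f^{i-1}(x)\}$. $\mathbb{A}(f)$ denotes the set of $x\in X$ such that $\omega(x,f)$ is a periodic orbit or an odometer. *)

(* Defs.v *)
From HB Require Import structures.
From mathcomp Require Import all_boot all_order all_algebra.
From mathcomp Require Import all_classical all_reals all_analysis.

Set Implicit Arguments.
Unset Strict Implicit.
Unset Printing Implicit Defensive.

Import Order.TTheory GRing.Theory Num.Theory.

Local Open Scope classical_set_scope.
Local Open Scope ring_scope.

(* The supremum is taken in the extended reals, so that an unbounded family of
   distances has supremum +oo (the supremum in [R] would be 0). *)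
Definition equicontinuous_at (R : realType) (X : metricType R) (f : X -> X)
    (x : X) : Prop :=
  forall eps : R, 0 < eps -> exists2 delta : R, 0 < delta &
    forall y : X, mdist x y <= delta ->
      (ereal_sup [set (mdist (iter i f x) (iter i f y))%:E | i in [set: nat]]
         <= eps%:E)%E.

Definition invariant_set (X : Type) (f : X -> X) (S : set X) : Prop :=
  f @` S `<=` S.

Definition omega_limit (X : topologicalType) (f : X -> X) (x : X) : set X :=
  [set y | exists2 u : nat -> nat, {homo u : i j / (i < j)%N} &
             iter (u j) f x @[j --> \oo] --> y].

(* The sequences are indexed from 0 instead of 1. *)
Record periodic_structure := PeriodicStructure {
  ps_seq :> nat -> nat;
  ps_gt0 : forall j, (0 < ps_seq j)%N;
  ps_nondecreasing : nondecreasing_seq ps_seq;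
  ps_dvd : forall j, (ps_seq j %| ps_seq j.+1)%N;
  ps_cvg : ps_seq j @[j --> \oo] --> \oo }.

Definition odometer_space (m : periodic_structure) :
    set (prod_topology (fun j : nat => discrete_topology 'I_(m j))) :=
  [set x | forall j, (x j : 'I_(m j)) = (x j.+1 : 'I_(m j.+1)) %[mod m j]].
Arguments odometer_space : clear implicits.

(* [ordS] is the successor modulo [n] on ['I_n]. *)
Definition odometer_succ (m : periodic_structure)
    (x : prod_topology (fun j : nat => discrete_topology 'I_(m j))) :
    prod_topology (fun j : nat => discrete_topology 'I_(m j)) :=
  fun j => ordS (x j : 'I_(m j)).

Lemma odometer_succ_subproof (m : periodic_structure) (x : odometer_space m) :
  odometer_succ (\val x) \in odometer_space m.
Proof.
apply/mem_set => j /=; have /set_mem/(_ j) /= xj := valP x.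
rewrite modn_mod modn_dvdm; last exact: ps_dvd.
by rewrite -addn1 -modnDml xj modnDml addn1.
Qed.

Definition odometer_map (m : periodic_structure) (x : odometer_space m) :
    odometer_space m :=
  exist _ (odometer_succ (\val x)) (odometer_succ_subproof x).

Definition homeomorphism (A B : topologicalType) (h : A -> B) : Prop :=
  continuous h /\
  exists k : B -> A, [/\ cancel h k, cancel k h & continuous k].

(* [odometer_space m] and [S] are used as types, on which the library puts the
   subspace topology. *)
Definition is_odometer (X : topologicalType) (f : X -> X) (S : set X) : Prop :=
  [/\ closed S, invariant_set f S &
      exists (m : periodic_structure) (h : odometer_space m -> S),
        homeomorphism h /\
        forall z, f (\val (h z)) = \val (h (odometer_map z))].

Definition is_periodic_orbit (X : topologicalType) (f : X -> X) (S : set X) :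
    Prop :=
  [/\ closed S, invariant_set f S &
      exists x i, [/\ S x, (0 < i)%N, iter i f x = x &
                      S = [set iter k f x | k in [set k | (k < i)%N]]]].

Definition periodic_or_odometer_points (X : topologicalType) (f : X -> X) :
    set X :=
  [set x | is_periodic_orbit f (omega_limit f x) \/
           is_odometer f (omega_limit f x)].

(* Main.v *)
(** Call [x] eventually limit periodic if for every [e > 0] there are [q > 0]
    and [N] such that [d(f^n x, f^(n + k q) x) <= e] for all [n >= N] and all
    [k].  This property passes from points of [A(f)] near an equicontinuity
    point [x] to [x] itself, because the orbits stay close forever.  It
    characterises [A(f)]:
    - if [omega(a, f)] is a periodic orbit or an odometer, it splits, at every
      scale [e], into finitely many disjoint clopen pieces of diameter at most
      [e] that [f] permutes cyclically, and the orbit of [a] eventually follows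
      this cycle;
    - conversely, if [x] is eventually limit periodic, fix [y] in
      [omega(x, f)].  Then [s n = f^n y] is dense in [omega(x, f)], and it is
      uniformly continuous for a topology on [Z] with a neighbourhood basis of
      [0] made of subgroups [r Z]; a suitable [r] for each scale makes the
      residue of [n] modulo [r] locally constant in [s n].  Reading off these
      residues along a divisibility chain identifies [omega(x, f)] with an
      odometer if the chain is unbounded; otherwise [omega(x, f)] is finite. *)

Require Import Defs.
From HB Require Import structures.
From mathcomp Require Import all_boot all_order all_algebra.
From mathcomp Require Import all_classical all_reals all_analysis.
From mathcomp Require Import ring lra zify.

Import Order.TTheory GRing.Theory Num.Theory.

Local Open Scope classical_set_scope.

(** * Metric neighbourhoods and uniform estimates from compactness *)

Section MetricFacts.
Context {R : realType} {X : metricType R}.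
Local Open Scope ring_scope.
Implicit Types (x y z : X) (e : R).

Lemma nbhs_mdist_ltP x (A : set X) :
  nbhs x A <-> exists2 e : R, 0 < e & forall y, mdist x y < e -> A y.
Proof.
split=> [/metricType_numDomainType.nbhs_mdistP [e e0 h]|[e e0 h]].
  by exists e => // y xy; apply: h.
by apply/metricType_numDomainType.nbhs_mdistP; exists e => // y; apply: h.
Qed.

Lemma continuous_mdistP (f : X -> X) x e : continuous f -> 0 < e ->
  exists2 d : R, 0 < d & forall y, mdist x y < d -> mdist (f x) (f y) < e.
Proof.
move=> cf e0; apply/(nbhs_mdist_ltP x [set y | mdist (f x) (f y) < e]).
by apply: (cf x [set y | mdist (f x) y < e]); apply/nbhs_mdist_ltP; exists e.
Qed.

Lemma continuous_iter (f : X -> X) n : continuous f -> continuous (iter n f).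
Proof.
move=> cf; elim: n => [|n IH] x; first exact: cvg_id.
exact: (continuous_comp (IH x) (cf _)).
Qed.

(** The near-covering form of compactness is applied with the radius [g] as parameter, tending to 0
    from the right. Halving [e] keeps both points in the ball around [x]. *)
Lemma lebesgue_number (K : set X) (P : X -> X -> Prop) : compact K ->
  (forall x, K x -> exists2 e : R, 0 < e &
     forall y z, mdist x y < e -> mdist x z < e -> P y z) ->
  exists2 g : R, 0 < g & forall y z, K y -> mdist y z < g -> P y z.
Proof.
move=> /compact_near_coveringP cK loc.
have := cK R (0^'+)%classic (fun g y => forall z, mdist y z < g -> P y z) _.
case=> [x Kx|g /= g0 H].
  have [e e0 Pe] := loc _ Kx.
  exists ([set y | mdist x y < e / 2], [set g | g < e / 2]) => /=.
    split; first by apply/nbhs_mdist_ltP; exists (e / 2) => //; lra.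
    by apply: nbhs_right_lt; lra.
  move=> [y g] /= [xy ge] z yz; have := metric_triangle x y z.
  by move=> xz; apply: Pe; lra.
exists (g / 2); first by rewrite divr_gt0.
move=> y z Ky yz; apply: (H (g / 2) _ _ y Ky) => //=; last by rewrite divr_gt0.
by rewrite sub0r normrN gtr0_norm ?divr_gt0//; lra.
Qed.

Lemma uniform_threshold (Q : nat -> R -> Prop) :
  (forall i d d', 0 < d -> d <= d' -> Q i d' -> Q i d) ->
  (forall i, exists2 d : R, 0 < d & Q i d) ->
  forall n, exists2 d : R, 0 < d & forall i, (i < n)%N -> Q i d.
Proof.
move=> mono ex; elim=> [|n [d d0 IH]]; first by exists 1; rewrite ?ltr01.
have [d' d'0 Qd'] := ex n.
have m0 : 0 < Num.min d d' by rewrite lt_min d0.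
exists (Num.min d d') => // i; rewrite ltnS leq_eqVlt => /orP[/eqP->|ilt].
  by apply: mono Qd' => //; rewrite ge_min lexx orbT.
by apply: mono (IH _ ilt) => //; rewrite ge_min lexx.
Qed.

Lemma compact_iter_unif (f : X -> X) : compact [set: X] -> continuous f ->
  forall n e, 0 < e -> exists2 d : R, 0 < d &
    forall i, (i < n)%N -> forall x y, mdist x y < d ->
      mdist (iter i f x) (iter i f y) < e.
Proof.
move=> cX cf n e e0.
apply: (uniform_threshold (fun i d => forall x y, mdist x y < d ->
  mdist (iter i f x) (iter i f y) < e)) => [i d d' _ dd' H x y xy|i].
  by apply: H; exact: lt_le_trans dd'.
have [|d d0 H] := lebesgue_number _
  (fun x y => mdist (iter i f x) (iter i f y) < e) cX.
  move=> x _; have e20 : 0 < e / 2 by lra.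
  have [d d0 H] := continuous_mdistP _ x _ (continuous_iter f i cf) e20.
  exists d => // y z /H xy /H xz.
  have := metric_triangle (iter i f y) (iter i f x) (iter i f z).
  by rewrite (metric_sym _ (iter i f x)); lra.
by exists d => // x y; apply: H.
Qed.

End MetricFacts.

(** * Limit periodic sequences *)

Section LimitPeriodic.
Context {R : realType} {X : metricType R}.
Local Open Scope ring_scope.
Implicit Types (s : nat -> X) (e : R).

Definition limit_periodic s := forall e, 0 < e -> exists2 q, (0 < q)%N &
  forall n k, mdist (s n) (s (n + k * q)%N) <= e.

(** Uniform equicontinuity, on the range of [s], of the iterates of the shift taking [s n] to
    [s n.+1]. *)
Definition shift_equicontinuous s := forall e, 0 < e -> exists2 d : R, 0 < d &
  forall a b n, mdist (s a) (s b) < d -> mdist (s (a + n)%N) (s (b + n)%N) <= e.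

(** The residue modulo [r] is a uniformly continuous function of [s n], so it extends to the closure
    of the range. *)
Definition separates_residues s (r : nat) := exists2 g : R, 0 < g &
  forall n m, mdist (s n) (s m) < g -> n = m %[mod r].

Lemma separates_residues_lcm s r r' : separates_residues s r ->
  separates_residues s r' -> separates_residues s (lcmn r r').
Proof.
move=> [g g0 H] [g' g'0 H']; exists (Num.min g g'); first by rewrite lt_min g0.
move=> n m; rewrite lt_min => /andP[/H nm /H'].
wlog le : n m nm / (n <= m)%N => [W|] nm'.
  by case: (leqP n m) => [|/ltnW] le; [exact: W|apply/esym/W].
by apply/esym/eqP; rewrite eqn_mod_dvd// dvdn_lcm -!eqn_mod_dvd// nm nm' !eqxx.
Qed.

(* [n] lies in the closure of [q Z] for the topology that [s] puts on [Z]. *)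
Definition near_multiple s (q n : nat) := forall e, 0 < e -> exists k,
  forall a, mdist (s (a + n)%N) (s (a + k * q)%N) <= e.

Lemma near_multiple_mul s q k : near_multiple s q (k * q).
Proof. by move=> e e0; exists k => a; rewrite mdistxx ltW. Qed.

Lemma near_multipleD s q n m :
  near_multiple s q n -> near_multiple s q m -> near_multiple s q (n + m).
Proof.
move=> Hn Hm e e0; have e20 : 0 < e / 2 by lra.
have [k Hk] := Hn _ e20; have [k' Hk'] := Hm _ e20.
exists (k + k')%N => a; have := Hk (a + m)%N; have := Hk' (a + k * q)%N.
have -> : (a + m + n = a + (n + m))%N by lia.
have -> : (a + m + k * q = a + k * q + m)%N by lia.
have -> : (a + k * q + k' * q = a + (k + k') * q)%N by lia.
have := metric_triangle (s (a + (n + m))%N) (s (a + k * q + m)%N)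
  (s (a + (k + k') * q)%N).
lra.
Qed.

Lemma near_multipleMn s q n k :
  near_multiple s q n -> near_multiple s q (k * n).
Proof.
move=> Hn; elim: k => [|k IH]; last by rewrite mulSn; apply: near_multipleD.
exact: (near_multiple_mul s q 0).
Qed.

(* Subtracting [n] amounts to adding [n (q - 1)] and removing [n q], which
   limit periodicity allows. *)
Lemma near_multipleB s q n m : (0 < q)%N -> limit_periodic s ->
  near_multiple s q n -> near_multiple s q (n + m) -> near_multiple s q m.
Proof.
case: q => // q _ LP Hn Hnm e e0; have e20 : 0 < e / 2 by lra.
have [k Hk] :=
  near_multipleD s q.+1 _ _ Hnm (near_multipleMn s q.+1 n q Hn) _ e20.
have [[//|p] _ Hp] := LP _ e20.
(* Moving by [q.+1 * n * p.+1] costs at most [e / 2]. One copy of [q.+1 * n] completes [m] to the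
   index treated by [Hk]; the other [p] copies are multiples of [q.+1] and enter the witness. *)
exists (k + p * n)%N => a.
have := Hk (a + p * q.+1 * n)%N; have := Hp (a + m)%N (q.+1 * n)%N.
have -> : (a + m + q.+1 * n * p.+1 = a + p * q.+1 * n + (n + m + q * n))%N.
  by ring.
have -> : (a + p * q.+1 * n + k * q.+1 = a + (k + p * n) * q.+1)%N by ring.
have := metric_triangle (s (a + m)%N)
  (s (a + p * q.+1 * n + (n + m + q * n))%N) (s (a + (k + p * n) * q.+1)%N).
lra.
Qed.

(** Near multiples are stable under addition and subtraction, so division by the least positive one
    leaves no remainder. *)
Lemma near_multiple_period s q : (0 < q)%N -> limit_periodic s ->
  exists2 r, (0 < r)%N & forall n, near_multiple s q n <-> (r %| n)%N.
Proof.
move=> q0 LP.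
have ex : exists r, (0 < r)%N && `[< near_multiple s q r >].
  exists q; rewrite q0; apply/asboolP.
  by have := near_multiple_mul s q 1; rewrite mul1n.
case: (ex_minnP ex) => r /andP[r0 /asboolP Hr] minr; exists r => // n.
split=> [Hn|/dvdnP[k ->]]; last exact: near_multipleMn.
rewrite /dvdn; case: posnP => // nr0.
have : near_multiple s q (n %% r).
  apply: (near_multipleB s q (n %/ r * r)) => //; last by rewrite -divn_eq.
  exact: near_multipleMn.
move=> /asboolP Hnr; have := minr (n %% r)%N; rewrite nr0 Hnr => /(_ isT).
by rewrite leqNgt ltn_mod r0.
Qed.

(** A small displacement at one time [n] controls every time [a]: shifting by [a + p * n] carries
    [n] to [a + n * p.+1], which the almost period [p.+1] brings back to [a]. *)
Lemma limit_periodic_shift s : limit_periodic s -> shift_equicontinuous s ->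
  forall e, 0 < e -> exists2 d : R, 0 < d & forall n m,
    mdist (s n) (s (n + m)%N) < d -> forall a, mdist (s a) (s (a + m)%N) <= e.
Proof.
move=> LP EQ e e0; have e30 : 0 < e / 3 by lra.
have [d d0 Hd] := EQ _ e30; have [[//|p] _ Hp] := LP _ e30.
exists d => // n m nm a.
have := Hd _ _ (a + p * n)%N nm; have := Hp a n; have := Hp (a + m)%N n.
have -> : (n + (a + p * n) = a + n * p.+1)%N by ring.
have -> : (n + m + (a + p * n) = a + m + n * p.+1)%N by ring.
have := metric_triangle (s a) (s (a + n * p.+1)%N) (s (a + m)%N).
have := metric_triangle (s (a + n * p.+1)%N) (s (a + m + n * p.+1)%N)
  (s (a + m)%N).
rewrite (metric_sym (s (a + m + n * p.+1)%N) (s (a + m)%N)); lra.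
Qed.

(** The near multiples of an almost period [q] are the multiples of [r]. Indices congruent modulo
    [r] differ by one of them, hence the bound [e]. Separation holds because a closed subgroup of
    finite index is open. *)
Lemma separating_period s : limit_periodic s -> shift_equicontinuous s ->
  forall e, 0 < e -> exists r, [/\ (0 < r)%N, separates_residues s r &
    forall n m, n = m %[mod r] -> mdist (s n) (s m) <= e].
Proof.
move=> LP EQ e e0; have e20 : 0 < e / 2 by lra.
have [q q0 Hq] := LP _ e20; have [r r0 Hr] := near_multiple_period s q q0 LP.
exists r; split=> //; last first.
  move=> n m; wlog le : n m / (n <= m)%N => [W|nm].
    case: (leqP n m) => [|/ltnW] le nm; first exact: W.
    by rewrite metric_sym; apply: W.
  have : (r %| m - n)%N by rewrite -eqn_mod_dvd// nm.
  move=> /Hr /(_ _ e20) [k /(_ n)]; rewrite subnKC// => h.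
  have := Hq n k; have := metric_triangle (s n) (s (n + k * q)%N) (s m).
  by rewrite (metric_sym (s (n + k * q)%N) (s m)); lra.
(* Failing to be a near multiple is witnessed by a positive distance; a common one for the [q]
   values [l * q.-1] is [d]. *)
have [|i|d d0 Hd] := uniform_threshold (fun l d =>
    (exists k, forall a, mdist (s (a + l * q.-1)%N) (s (a + k * q)%N) <= d) ->
    near_multiple s q (l * q.-1)) _ _ q.
- move=> i d d' _ dd' H [k Hk]; apply: H; exists k => a.
  exact: le_trans dd'.
- have [h|h] := pselect (near_multiple s q (i * q.-1)).
    by exists 1; rewrite ?ltr01.
  move: (h); rewrite /near_multiple => /existsNP[d /not_implyP[d0 H]].
  by exists d.
have [g g0 Hg] := limit_periodic_shift s LP EQ _ d0.
exists g => // n m; wlog le : n m / (n <= m)%N => [W|nm].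
  case: (leqP n m) => [|/ltnW] le; first exact: W.
  by rewrite metric_sym => ?; apply/esym/W.
suff : near_multiple s q (m - n) by move=> /Hr; rewrite -eqn_mod_dvd// => /eqP.
have {}nm a : mdist (s a) (s (a + (m - n))%N) <= d.
  by apply: (Hg n); rewrite subnKC.
set L := (m - n)%N in nm *.
(* Modulo [q] this number is the opposite of [L]: adding [L], which moves [s] by at most [d], yields
   a true multiple of [q]. *)
have H1 : near_multiple s q (L %% q * q.-1).
  apply: Hd; first by rewrite ltn_mod.
  exists (L %% q + L %/ q)%N => a; have := nm (a + L %% q * q.-1)%N.
  suff -> : (a + L %% q * q.-1 + L = a + (L %% q + L %/ q) * q)%N by [].
  have := divn_eq L q; move: (L %% q)%N (L %/ q)%N => l t ->.
  by move: q0; case: (q) => // q' _ /=; ring.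
have H2 : near_multiple s q (L %% q).
  apply: (near_multipleB s q _ _ q0 LP H1).
  suff -> : (L %% q * q.-1 + L %% q = L %% q * q)%N by exact: near_multiple_mul.
  by rewrite -mulnSr (prednK q0).
rewrite (divn_eq L q); apply: near_multipleD => //; exact: near_multiple_mul.
Qed.

End LimitPeriodic.

(** * Omega-limit sets and cyclic colorings *)

Section OmegaLimit.
Context {R : realType} {X : metricType R} (f : X -> X).
Local Open Scope ring_scope.
Implicit Types (x y : X) (e : R).

Lemma omega_limitP x y : omega_limit f x y <->
  forall e N, 0 < e -> exists2 n, (N <= n)%N & mdist (iter n f x) y < e.
Proof.
split=> [[u uinc ucvg] e N e0|H].
  have [J _ HJ] := metricType_numDomainType.cvgr_dist_lt ucvg e0.
  exists (u (maxn J N)); last by rewrite metric_sym; apply: HJ; exact: leq_maxl.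
  have uge j : (j <= u j)%N.
    by elim: j => // j IH; apply: leq_ltn_trans IH (uinc _ _ _).
  exact: leq_trans (leq_maxr J N) (uge _).
have /choice[g Hg] : forall Nj : nat * nat, exists n, (Nj.1 <= n)%N /\
    mdist (iter n f x) y < Nj.2.+1%:R^-1.
  move=> [N j] /=; have j0 : 0 < j.+1%:R^-1 :> R by rewrite invr_gt0.
  by have [n] := H _ N j0; exists n.
(* The first argument of [g] makes the times strictly increase, the second forces convergence. *)
pose u := fix u j := if j is i.+1 then g ((u i).+1, j) else g (0%N, 0%N).
exists u.
  by apply: homo_ltn ltn_trans _ => i; case: (Hg ((u i).+1, i.+1)).
apply/metricType_numDomainType.cvgrPdist_lt => e e0.
have := near_infty_natSinv_lt (PosNum e0); apply: filterS => j /=.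
apply: lt_trans; rewrite metric_sym.
by case: j => [|j] /=; [case: (Hg (0, 0)%N)|case: (Hg ((u j).+1, j.+1))].
Qed.

Lemma closed_omega_limit x : closed (omega_limit f x).
Proof.
move=> y cly; apply/omega_limitP => e N e0; have e20 : 0 < e / 2 by lra.
have [|z [/omega_limitP/(_ _ N e20)[n Nn xz] /= yz]] :=
  cly [set z | mdist y z < e / 2].
  by apply/nbhs_mdist_ltP; exists (e / 2).
exists n => //; have := metric_triangle (iter n f x) z y.
by rewrite (metric_sym z y); lra.
Qed.

Lemma invariant_omega_limit x : continuous f ->
  invariant_set f (omega_limit f x).
Proof.
move=> cf _ [y /omega_limitP xy <-]; apply/omega_limitP => e N e0.
have [d d0 Hd] := continuous_mdistP f y e cf e0.
have [n Nn ny] := xy d N d0.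
by exists n.+1; [exact: leqW|rewrite metric_sym; apply: Hd; rewrite metric_sym].
Qed.

(** Near a limit point the claim is immediate; any other point has a ball that the orbit eventually
    avoids, where the claim is vacuous for large [n]. Compactness makes the threshold uniform. *)
Lemma omega_limit_attracts x e : compact [set: X] -> 0 < e ->
  exists N, forall n, (N <= n)%N ->
    exists2 y, omega_limit f x y & mdist (iter n f x) y < e.
Proof.
move=> /compact_near_coveringP cX e0.
have [|N _ HN] := cX nat \oo (fun n z => z = iter n f x ->
    exists2 y, omega_limit f x y & mdist z y < e) _; last first.
  by exists N => n Nn; exact: (HN n Nn _ I erefl).
move=> y _; have [xy|/omega_limitP xy] := pselect (omega_limit f x y).
  exists ([set z | mdist y z < e], setT).
    by split; [apply/nbhs_mdist_ltP; exists e|exact: filterT].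
  by move=> [z n] [/= yz _] _; exists y; rewrite // metric_sym.
have {xy} [d [d0 [N HN]]] : exists d : R, 0 < d /\ exists N, forall n,
    (N <= n)%N -> ~ mdist (iter n f x) y < d.
  move/existsNP: xy => [d /existsNP[N /not_implyP[d0 xy]]].
  by exists d; split => //; exists N => n Nn nd; apply: xy; exists n.
exists ([set z | mdist y z < d], [set n | (N <= n)%N]).
  by split; [apply/nbhs_mdist_ltP; exists d|exists N].
by move=> [z n] [/= yz Nn] zn; have := HN _ Nn; rewrite -zn metric_sym.
Qed.

End OmegaLimit.

Section Coloring.
Context {R : realType} {X : metricType R} (f : X -> X).
Local Open Scope ring_scope.
Implicit Types (x y : X) (e : R).

(* A factor map from [(S, f)] onto the rotation of [Z/r] whose fibres have
   diameter at most [e]; [g] witnesses its uniform continuity. *)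
Definition cyclic_coloring (S : set X) e := exists (r : nat) (c : X -> nat),
  [/\ (0 < r)%N,
      exists2 g : R, 0 < g & forall y z, S y -> S z -> mdist y z < g ->
        c y = c z %[mod r],
      forall y, S y -> c (f y) = (c y).+1 %[mod r] &
      forall y z, S y -> S z -> c y = c z %[mod r] -> mdist y z <= e].

Definition eventually_limit_periodic x := forall e, 0 < e -> exists q N,
  (0 < q)%N /\ forall n k, (N <= n)%N ->
    mdist (iter n f x) (iter (n + k * q) f x) <= e.

(** Late iterates are shadowed by points [y n] of the limit set. Both [f (y n)] and [y n.+1] are
    close to the next iterate, so they share a color; thus colors advance by one and return after
    [r] steps. *)
Lemma coloring_eventually_limit_periodic x : compact [set: X] -> continuous f ->
  (forall e, 0 < e -> cyclic_coloring (omega_limit f x) e) ->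
  eventually_limit_periodic x.
Proof.
move=> cX cf col e e0; have e30 : 0 < e / 3 by lra.
have [r [c [r0 [g g0 Hg] cS Hc]]] := col _ e30.
have g20 : 0 < g / 2 by lra.
have [d d0 Hd] := compact_iter_unif f cX cf 2 _ g20.
have m0 : 0 < Num.min (e / 3) (Num.min d (g / 2)) by rewrite !lt_min e30 d0.
have [N HN] := omega_limit_attracts f x _ cX m0.
have /choice[y Hy] : forall n, exists y, (N <= n)%N ->
    [/\ omega_limit f x y, mdist (iter n f x) y < e / 3,
        mdist (iter n f x) y < d & mdist (iter n f x) y < g / 2].
  move=> n; have [/HN[y xy]|nN] := leqP N n; last by exists x.
  by rewrite !lt_min => /and3P[? ? ?]; exists y.
exists r, N; split=> // n k Nn.
have cy j : c (y (n + j)%N) = (c (y n) + j)%N %[mod r].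
  elim: j => [|j IH]; first by rewrite !addn0.
  have Nj : (N <= n + j)%N by lia.
  have Nj1 : (N <= n + j.+1)%N by lia.
  have [w1 _ h1 _] := Hy _ Nj; have [w2 _ _ h2] := Hy _ Nj1.
  have -> : c (y (n + j.+1)%N) = c (f (y (n + j)%N)) %[mod r].
    apply/esym/Hg => //.
      by apply: (invariant_omega_limit f x cf); exists (y (n + j)%N).
    have := Hd 1%N isT _ _ h1; rewrite /= -iterS -addnS.
    have := metric_triangle (f (y (n + j)%N)) (iter (n + j.+1) f x)
      (y (n + j.+1)%N).
    by rewrite (metric_sym (f (y (n + j)%N)) (iter (n + j.+1) f x)); lra.
  by rewrite cS// addnS -addn1 -modnDml IH modnDml addn1.
have Nk : (N <= n + k * r)%N by lia.
have [w1 h1 _ _] := Hy _ Nn; have [w2 h2 _ _] := Hy _ Nk.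
have /Hc : c (y n) = c (y (n + k * r)%N) %[mod r].
  by rewrite cy addnC modnMDl.
move=> /(_ w1 w2) h3.
have := metric_triangle (iter n f x) (y n) (iter (n + k * r) f x).
have := metric_triangle (y n) (y (n + k * r)%N) (iter (n + k * r) f x).
rewrite (metric_sym (y (n + k * r)%N) (iter (n + k * r) f x)); lra.
Qed.

(** Reducing [n] modulo an almost period [q] leaves only the first [q] iterates to control. *)
Lemma limit_periodic_orbit_equicontinuous x : compact [set: X] ->
  continuous f -> limit_periodic (fun n => iter n f x) ->
  shift_equicontinuous (fun n => iter n f x).
Proof.
move=> cX cf LP e e0; have e30 : 0 < e / 3 by lra.
have [q q0 Hq] := LP _ e30.
have [d d0 Hd] := compact_iter_unif f cX cf q _ e30.
exists d => // a b n ab.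
have iq : (n %% q < q)%N by rewrite ltn_mod.
have En c : (c + n = c + n %% q + n %/ q * q)%N.
  by rewrite -addnA [(_ %% _ + _)%N]addnC -divn_eq.
have := Hd _ iq _ _ ab; rewrite -!iterD ![(_ %% _ + _)%N]addnC !En.
move: (Hq (a + n %% q)%N (n %/ q)%N) (Hq (b + n %% q)%N (n %/ q)%N).
set a2 := iter (a + n %% q) f x; set b2 := iter (b + n %% q) f x.
set a1 := iter _ f x; set b1 := iter _ f x.
have := metric_triangle a1 b2 b1; have := metric_triangle a1 a2 b2.
by rewrite (metric_sym a1 a2); lra.
Qed.

Lemma periodic_orbit_coloring (S : set X) e : compact [set: X] ->
  continuous f -> is_periodic_orbit f S -> 0 < e -> cyclic_coloring S e.
Proof.
move=> cX cf [_ _ [x [p [_ p0 px ->]]]] e0.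
have LP : limit_periodic (fun n => iter n f x).
  move=> d d0; exists p => // n k; rewrite iterD.
  suff -> : iter (k * p) f x = x by rewrite mdistxx ltW.
  by elim: k => // k IH; rewrite mulSn iterD IH.
have [r [r0 [g g0 Hg] Hr]] := separating_period _ LP
  (limit_periodic_orbit_equicontinuous x cX cf LP) e e0.
(* [c y] is some index of [y] along the orbit, 0 by default off it. Two indices of one point agree
   modulo [r], their values being at distance 0. *)
have /choice[c Hc] : forall y, exists n, (exists k, iter k f x = y) ->
    iter n f x = y.
  move=> y; have [[k ky]|ny] := pselect (exists k, iter k f x = y).
    by exists k.
  by exists 0%N.
exists r, c; split=> //.
- exists g => // y z [i _ iy] [j _ jz] yz.
  by apply: Hg; rewrite !Hc//; [exists j|exists i].
- move=> _ [i _ <-]; apply: Hg => /=; rewrite !Hc ?mdistxx//; first by exists i.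
  by exists i.+1.
- move=> y z [i _ iy] [j _ jz] /Hr; rewrite !Hc//; first by exists j.
  by exists i.
Qed.

End Coloring.

(** * Odometers *)

Section OdometerSpace.
Context (m : periodic_structure).
Implicit Types (z w : odometer_space m).

Definition digit z (j : nat) : nat := (\val z j : 'I_(m j)).

Lemma digit_lt z j : (digit z j < m j)%N.
Proof. exact: ltn_ord. Qed.

Lemma ps_dvd_le i j : (i <= j)%N -> (m i %| m j)%N.
Proof.
move=> /subnKC <-; elim: (j - i)%N => [|k IH]; first by rewrite addn0.
by rewrite addnS; apply: dvdn_trans IH (ps_dvd _ _).
Qed.

Lemma digit_mod z i j : (i <= j)%N -> digit z i = (digit z j %% m i)%N.
Proof.
move=> /subnKC <-; elim: (j - i)%N => [|k IH].
  by rewrite addn0 modn_small// digit_lt.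
rewrite addnS IH; have /set_mem/(_ (i + k)%N) zk := valP z.
rewrite -(modn_dvdm (digit z (i + k)) (ps_dvd_le i (i + k) (leq_addr _ _))).
by rewrite [X in (X %% _)%N]zk modn_dvdm// ps_dvd_le// leq_addr.
Qed.

Lemma eq_digit z w i j : (i <= j)%N ->
  digit z j = digit w j -> digit z i = digit w i.
Proof. by move=> ij zw; rewrite !(digit_mod _ _ _ ij) zw. Qed.

Lemma digit_inj z w : (forall j, digit z j = digit w j) -> z = w.
Proof.
move=> zw; apply/val_inj/functional_extensionality_dep => j.
exact/ord_inj/zw.
Qed.

Lemma digit_succ z j : digit (odometer_map z) j = ((digit z j).+1 %% m j)%N.
Proof. by []. Qed.

Lemma nbhs_digit z j : nbhs z [set w | digit w j = digit z j].
Proof.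
have pz :=
  @proj_continuous nat (fun j => discrete_topology 'I_(m j)) j (\val z).
have vz := @initial_continuous _ _ (set_val : odometer_space m -> _) z.
have dz := @discrete_set1 (discrete_topology 'I_(m j)) (\val z j).
have nz : nbhs z (set_val @^-1` (proj j @^-1` [set \val z j])).
  exact: vz (pz _ dz).
by apply: filterS nz => w /= /(congr1 (@nat_of_ord (m j))).
Qed.

(** A digit determines all earlier ones, so the cylinders around [z] generate a filter [G]. It
    converges to [z] coordinatewise, hence in the product. *)
Lemma nbhs_digitP z (A : set (odometer_space m)) : nbhs z A ->
  exists j, forall w, digit w j = digit z j -> A w.
Proof.
pose G : set_system (odometer_space m) :=
  filter_from setT (fun j => [set w | digit w j = digit z j]).
have FG : Filter G.
  apply: filter_from_filter; first by exists 0%N.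
  move=> i j _ _; exists (maxn i j) => // w /= wz; split=> /=.
    exact: eq_digit (leq_maxl _ _) wz.
  exact: eq_digit (leq_maxr _ _) wz.
have cG : \val @ G -->
    (\val z : prod_topology (fun j => discrete_topology 'I_(m j))).
  apply/cvg_sup => i; move=> B [/= _ [[V _ <-] Vz VB]].
  exists i => // w /= wz; apply: VB => /=.
  by have -> : \val w i = \val z i by apply: ord_inj.
move=> [_ [/= [W oW <-] Wz WA]].
have [j _ Hj] : (\val @ G) W by apply: cG; apply: open_nbhs_nbhs.
by exists j => w wz; apply: WA; apply: Hj.
Qed.

End OdometerSpace.

Lemma nbhs_subtypeP {R : realType} {X : metricType R} (S : set X) (s : S)
    (A : set S) :
  nbhs s A <-> exists2 e : R, (0 < e)%R &
    forall t : S, (mdist (\val s) (\val t) < e)%R -> A t.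
Proof.
split=> [[_ [/= [W oW <-] Ws WA]]|[e e0 He]].
  have /nbhs_mdist_ltP[e e0 He] : nbhs (\val s) W by apply: open_nbhs_nbhs.
  by exists e => // t st; apply: WA; apply: He.
have := @initial_continuous _ _ (set_val : S -> X) s.
move=> /(_ [set y | (mdist (\val s) y < e)%R] _) h.
have ns : nbhs s (set_val @^-1` [set y | (mdist (\val s) y < e)%R]).
  by apply: h; apply/nbhs_mdist_ltP; exists e.
by apply: filterS ns => t; exact: He.
Qed.

Section OdometerColoring.
Context {R : realType} {X : metricType R} (f : X -> X).
Local Open Scope ring_scope.

(** The color is the [j]-th digit read through [h], with [j] so large that points sharing it are
    less than [e] apart. *)
Lemma odometer_coloring (S : set X) (e : R) : compact [set: X] ->
  is_odometer f S -> 0 < e -> cyclic_coloring f S e.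
Proof.
move=> cX [clS invS [m [h [[ch [k [hk kh ck]]] hf]]]] e0.
have sval x (Sx : S x) : exists z, \val (h z) = x.
  by exists (k (exist _ x (mem_set Sx))); rewrite kh.
have Sh z : S (\val (h z)) by exact: set_mem (valP (h z)).
(* Digits become functions on all of [X], with default 0 off [S]; injectivity of [h] makes them well
   defined. *)
have /choice[c0 Hc0] : forall jx : nat * X, exists n : nat,
    forall z, \val (h z) = jx.2 -> n = digit m z jx.1.
  move=> [j x] /=; have [Sx|nS] := pselect (S x); last first.
    by exists 0%N => z zx; case: nS; rewrite -zx; exact: Sh.
  have [z zx] := sval _ Sx; exists (digit m z j) => w wx.
  by congr digit; apply: (can_inj hk); apply: val_inj; exact: etrans (esym wx).
pose c j x := c0 (j, x).
have cE j z : c j (\val (h z)) = digit m z j by exact: Hc0.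
have cS : compact S by apply: subclosed_compact clS cX _.
have [j Hj] : exists j, forall x y, S x -> S y -> c j x = c j y ->
    mdist x y < e.
  have [|N _ HN] := (compact_near_coveringP _).1 cS nat \oo (fun j x =>
      S x -> forall y, S y -> c j x = c j y -> mdist x y < e) _; last first.
    exists N => x y Sx Sy; exact: (HN N (leqnn N)).
  move=> x Sx; have [z zx] := sval _ Sx; have e20 : 0 < e / 2 by lra.
  have : nbhs (h z) [set t : S | mdist (\val (h z)) (\val t) < e / 2].
    by apply/nbhs_subtypeP; exists (e / 2).
  move=> /ch /nbhs_digitP[j Hj].
  have : nbhs (h z) (k @^-1` [set w | digit m w j = digit m z j]).
    by apply: ck; rewrite hk; exact: nbhs_digit.
  move=> /nbhs_subtypeP[d d0 Hd].
  (* Points of [S] close to [x] share its digit [j]. Agreement of [y'] with [y] at a level [i >= j]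
     gives agreement at level [j], so both lie within [e / 2] of [x]. *)
  exists ([set y | mdist x y < d], [set i | (j <= i)%N]).
    by split; [apply/nbhs_mdist_ltP; exists d|exists j].
  move=> [y i] [/= xy ji] Sy y' Sy'.
  have [w wy] := sval _ Sy; have [w' wy'] := sval _ Sy'; subst x y y'.
  have /= := Hd _ xy; rewrite hk !cE => dw /(eq_digit _ _ _ _ _ ji) ww'.
  have /= h1 := Hj _ dw; have /= h2 := Hj w' (etrans (esym ww') dw).
  have := metric_triangle (\val (h w)) (\val (h z)) (\val (h w')).
  by rewrite (metric_sym (\val (h w)) (\val (h z))); lra.
have cmod x : S x -> (c j x %% m j)%N = c j x.
  by move=> /sval[z <-]; rewrite cE modn_small// digit_lt.
exists (m j), (c j); split=> [|||x y Sx Sy].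
- exact: ps_gt0.
- have [|g g0 Hg] := lebesgue_number S
      (fun x y => S x -> S y -> c j x = c j y) cS.
    move=> x Sx; have [z zx] := sval _ Sx.
    have : nbhs (h z) (k @^-1` [set w | digit m w j = digit m z j]).
      by apply: ck; rewrite hk; exact: nbhs_digit.
    move=> /nbhs_subtypeP[d d0 Hd]; exists d => // y y' xy xy' Sy Sy'.
    have [w wy] := sval _ Sy; have [w' wy'] := sval _ Sy'; subst x y y'.
    have /= := Hd _ xy; have /= := Hd _ xy'; rewrite !hk !cE.
    by move=> -> ->.
  by exists g => // x y Sx Sy xy; rewrite (Hg x y).
- by move=> x /sval[z <-]; rewrite hf !cE digit_succ modn_mod.
- by rewrite !cmod// => /Hj xy; apply/ltW/xy.
Qed.

End OdometerColoring.

(** * From limit periodicity to an odometer *)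

Section Classification.
Context {R : realType} {X : metricType R} (f : X -> X).
Local Open Scope ring_scope.
Implicit Types (x y : X) (e : R).

Lemma omega_limit_iter x y n : continuous f ->
  omega_limit f x y -> omega_limit f x (iter n f y).
Proof.
move=> cf xy; elim: n => // n IH.
by apply: (invariant_omega_limit f x cf); exists (iter n f y).
Qed.

(** The estimate passes to the limit along the orbit of [x]; the threshold [N] disappears because
    limit points are approached at arbitrarily late times. *)
Lemma omega_limit_periodic x y : continuous f ->
  eventually_limit_periodic f x -> omega_limit f x y ->
  limit_periodic (fun n => iter n f y).
Proof.
move=> cf ELP xy e e0; have e30 : 0 < e / 3 by lra.
have [q [N [q0 HN]]] := ELP _ e30; exists q => // n k.
have {xy} := omega_limit_iter x y n cf xy.
rewrite addnC iterD; move: (iter n f y) => z /omega_limitP xz.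
have [d d0 Hd] := continuous_mdistP (iter (k * q) f) z _
  (continuous_iter f _ cf) e30.
have [|i Ni] := xz (Num.min d (e / 3)) N; first by rewrite lt_min d0.
rewrite lt_min => /andP[iz1 iz2].
have := Hd (iter i f x); rewrite metric_sym => /(_ iz1); rewrite -iterD addnC.
have := HN i k Ni; set u := iter i f x in iz1 iz2 *; set v := iter (i + _) f x.
have := metric_triangle z v (iter (k * q) f z).
have := metric_triangle z u v.
by rewrite (metric_sym z u) (metric_sym v); lra.
Qed.

(** The orbit of [x] passes near [y] at time [n] and near [z] at a later time [n']. Reducing
    [n' - n] modulo [q] allows [d] to be fixed before both times. *)
Lemma omega_limit_minimal x y z e : compact [set: X] -> continuous f ->
  eventually_limit_periodic f x -> omega_limit f x y -> omega_limit f x z ->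
  0 < e -> exists n, mdist (iter n f y) z < e.
Proof.
move=> cX cf ELP /omega_limitP xy /omega_limitP xz e0.
have e30 : 0 < e / 3 by lra.
have [q [N [q0 HN]]] := ELP _ e30.
have [d d0 Hd] := compact_iter_unif f cX cf q _ e30.
have [n Nn ny] := xy d N d0; have [n' nn' nz] := xz _ n e30.
have iq : ((n' - n) %% q < q)%N by rewrite ltn_mod.
exists ((n' - n) %% q)%N; have := Hd _ iq _ _ ny; rewrite -iterD.
have := HN ((n' - n) %% q + n)%N ((n' - n) %/ q)%N.
have -> : ((n' - n) %% q + n + (n' - n) %/ q * q = n')%N.
  by rewrite addnAC [X in (X + n)%N]addnC -divn_eq subnK.
move=> /(_ (leq_trans Nn (leq_addl _ _))).
set i := (_ %% _)%N; set u := iter i f y; set v := iter _ f x.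
have := metric_triangle u v z; have := metric_triangle v (iter n' f x) z.
by rewrite (metric_sym u v); lra.
Qed.

Lemma mdist_le_inv_eq x y : (forall j, mdist x y <= j.+1%:R^-1) -> x = y.
Proof.
move=> xy; apply/eqP/negP => /negP; rewrite -mdist_gt0 => d0.
have [N _ /(_ N (leqnn N)) /=] := near_infty_natSinv_lt (PosNum d0).
by rewrite ltNge xy.
Qed.

(* The periods [r j] are replaced by successive least common multiples. *)
Lemma separating_sequence (s : nat -> X) :
  limit_periodic s -> shift_equicontinuous s -> exists M : nat -> nat,
  [/\ forall j, (0 < M j)%N, forall j, (M j %| M j.+1)%N,
      forall j, separates_residues s (M j) &
      forall j n m, n = m %[mod M j] -> mdist (s n) (s m) <= j.+1%:R^-1].
Proof.
move=> LP EQ.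
have /choice[r Hr] : forall j, exists r : nat,
    [/\ (0 < r)%N, separates_residues s r & forall n m, n = m %[mod r] ->
      mdist (s n) (s m) <= j.+1%:R^-1].
  by move=> j; apply: separating_period; rewrite ?invr_gt0.
pose M := fix M j := if j is i.+1 then lcmn (M i) (r j) else r 0%N.
have rM j : (r j %| M j)%N by case: j => //= j; exact: dvdn_lcmr.
exists M; split.
- by elim=> [|j IH] /=; [case: (Hr 0%N)|rewrite lcmn_gt0 IH; case: (Hr j.+1)].
- by move=> j /=; exact: dvdn_lcml.
- elim=> [|j IH] /=; first by case: (Hr 0%N).
  by apply: separates_residues_lcm => //; case: (Hr j.+1).
- move=> j n m nm; have [_ _] := Hr j; apply.
  by rewrite -(modn_dvdm n (rM j)) nm modn_dvdm.
Qed.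

(** All [M j] divide [B!], so [s] has exact period [B!], and its finite range is both dense in [W]
    and closed. *)
Lemma dense_bounded_periods (s : nat -> X) (M : nat -> nat) (W : set X) B :
  (forall n, s n = iter n f (s 0%N)) -> (forall n, W (s n)) ->
  (forall z e, W z -> 0 < e -> exists n, mdist (s n) z < e) ->
  closed W -> invariant_set f W ->
  (forall j, 0 < M j <= B)%N ->
  (forall j n m, n = m %[mod M j] -> mdist (s n) (s m) <= j.+1%:R^-1) ->
  is_periodic_orbit f W.
Proof.
move=> sE Ws dW clW invW MB Md; set p := B`!; have p0 : (0 < p)%N.
  exact: fact_gt0.
have sp n m : n = m %[mod p] -> s n = s m.
  move=> nm; apply: mdist_le_inv_eq => j; apply: Md.
  have Mp : (M j %| p)%N by exact: dvdn_fact.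
  by rewrite -(modn_dvdm n Mp) nm modn_dvdm.
split=> //; exists (s 0%N), p; split=> //.
  by rewrite -sE; apply: sp; rewrite modnn mod0n.
apply/seteqP; split=> [z Wz|_ [k _ <-]]; last by rewrite -sE.
have [//|nz] := pselect ([set iter k f (s 0%N) | k in [set k | (k < p)%N]] z).
have [|i|d d0 Hd] := uniform_threshold (fun i d => (i < p)%N ->
    ~ mdist (s i) z < d) _ _ p.
- by move=> i d d' _ dd' H ip /lt_le_trans/(_ dd')/H; apply.
- have [ip|_] := boolP (i < p)%N; last by exists 1; rewrite ?ltr01.
  exists (mdist (s i) z); last by rewrite ltxx.
  by rewrite mdist_gt0; apply/eqP => iz; apply: nz; exists i; rewrite -?sE.
have [n nz'] := dW _ _ Wz d0.
have np : (n %% p < p)%N by rewrite ltn_mod.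
by case: (Hd _ np np); rewrite (sp _ n)// modn_mod.
Qed.

(** Residues extend from the dense orbit to [W] and give the digits of a map [k] into the odometer.
    Small fibres make [k] injective and its inverse [h] continuous. *)
Lemma dense_unbounded_periods (s : nat -> X) (m : periodic_structure)
    (W : set X) :
  continuous f -> (forall n, s n = iter n f (s 0%N)) -> (forall n, W (s n)) ->
  (forall z e, W z -> 0 < e -> exists n, mdist (s n) z < e) ->
  compact W -> closed W -> invariant_set f W ->
  (forall j, separates_residues s (m j)) ->
  (forall j n n', n = n' %[mod m j] -> mdist (s n) (s n') <= j.+1%:R^-1) ->
  is_odometer f W.
Proof.
move=> cf sE Ws dW cW clW invW sep diam; split=> //; exists m.
(* [c (j, z)] is the residue modulo [m j] of all [n] with [s n] close to [z]. *)
have /choice[c Hc] : forall jz : nat * X, exists c : nat,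
    (c < m jz.1)%N /\ (W jz.2 -> exists2 e : R, 0 < e &
      forall n, mdist (s n) jz.2 < e -> (n %% m jz.1)%N = c).
  move=> [j z] /=; have [Wz|nW] := pselect (W z); last first.
    by exists 0%N; split=> //; exact: ps_gt0.
  have [g g0 Hg] := sep j; have g20 : 0 < g / 2 by lra.
  have [n nz] := dW _ _ Wz g20.
  exists (n %% m j)%N; split; first by rewrite ltn_mod ps_gt0.
  move=> _; exists (g / 2) => // n' /= n'z; apply: Hg.
  have := metric_triangle (s n') z (s n).
  by rewrite (metric_sym z); lra.
have cP j z : W z -> exists2 e : R, 0 < e &
    forall n, mdist (s n) z < e -> (n %% m j)%N = c (j, z).
  by case: (Hc (j, z)).
have compat j z : W z -> (c (j, z) = c (j.+1, z) %[mod m j])%N.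
  move=> Wz; have [e e0 He] := cP j z Wz; have [e' e'0 He'] := cP j.+1 z Wz.
  have [|n] := dW z (Num.min e e') Wz; first by rewrite lt_min e0.
  rewrite lt_min => /andP[/He <- /He' <-].
  by rewrite modn_mod modn_dvdm// ps_dvd.
(* The points are only approximated by values of [s], hence the margin [eta]. *)
have fibre j z z' : W z -> W z' -> c (j, z) = c (j, z') ->
    mdist z z' <= j.+1%:R^-1.
  move=> Wz Wz' cc; apply/ler_addgt0Pr => eta eta0.
  have [e e0 He] := cP j z Wz; have [e' e'0 He'] := cP j z' Wz'.
  have [|n] := dW z (Num.min e (eta / 2)) Wz; first by rewrite lt_min e0; lra.
  have [|n'] := dW z' (Num.min e' (eta / 2)) Wz'.
    by rewrite lt_min e'0; lra.
  rewrite !lt_min => /andP[/He' n'z' d'] /andP[/He nz d].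
  have /diam : n = n' %[mod m j] by rewrite nz n'z'.
  move: (j.+1%:R^-1) => u.
  have := metric_triangle z (s n) z'; have := metric_triangle (s n) (s n') z'.
  by rewrite (metric_sym z (s n)); lra.
have cf_succ j z : W z -> c (j, f z) = ((c (j, z)).+1 %% m j)%N.
  move=> Wz; have Wfz : W (f z) by apply: invW; exists z.
  have [e e0 He] := cP j z Wz; have [e' e'0 He'] := cP j _ Wfz.
  have [d d0 Hd] := continuous_mdistP f z _ cf e'0.
  have [|n] := dW z (Num.min e d) Wz; first by rewrite lt_min e0.
  rewrite lt_min => /andP[/He <- nz].
  rewrite -(He' n.+1); first by rewrite -addn1 -modnDml addn1.
  by rewrite sE iterS -sE metric_sym Hd// metric_sym.
have clt j z : (c (j, z) < m j)%N by case: (Hc (j, z)).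
pose digits z : prod_topology (fun j => discrete_topology 'I_(m j)) :=
  fun j => Ordinal (clt j z).
have kin (z : W) : digits (\val z) \in odometer_space m.
  by apply/mem_set => j /=; apply: compat; exact: set_mem (valP z).
pose k (z : W) : odometer_space m :=
  exist (fun d => d \in odometer_space m) _ (kin z).
have kE z j : digit m (k z) j = c (j, \val z) by [].
(* A preimage of [w] is a cluster point of the points [s (digit m w i)]: for [i >= j], the index
   [digit m w i] has residue [digit m w j] modulo [m j]. *)
have /choice[h Hh] : forall w : odometer_space m, exists z : W, k z = w.
  move=> w; pose t j := s (digit m w j).
  have tW : (t @ \oo) W by exists 0%N => // i _; exact: Ws.
  have [z [Wz clz]] := cW _ _ tW.
  exists (exist _ z (mem_set Wz)); apply: digit_inj => j.
  have [e e0 He] := cP j z Wz.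
  have [||_ [[i ji <-] iz]] := clz [set t i | i in [set i | (j <= i)%N]]
      [set y | mdist z y < e].
  - by exists j => // i /= ji; exists i.
  - by apply/nbhs_mdist_ltP; exists e.
  by rewrite kE (digit_mod m w j i ji) -(He (digit m w i)) 1?metric_sym.
have hk : cancel k h.
  move=> z; apply: val_inj; apply: mdist_le_inv_eq => j; apply: fibre.
  - exact: set_mem (valP (h (k z))).
  - exact: set_mem (valP z).
  - by rewrite -!kE Hh.
exists h; split=> [|w]; last first.
  have Wh : W (\val (h w)) by exact: set_mem (valP (h w)).
  apply: mdist_le_inv_eq => j; apply: fibre.
  - by apply: invW; exists (\val (h w)).
  - exact: set_mem (valP (h _)).
  - by rewrite cf_succ// -!kE !Hh.
split.
  move=> w A /nbhs_subtypeP[e e0 He].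
  have [j _ /(_ j (leqnn j)) /= je] := near_infty_natSinv_lt (PosNum e0).
  have nw := nbhs_digit m w j.
  apply: (@filterS _ _ _ _ _ _ nw) => w' /= ww'; apply: He.
  apply: le_lt_trans je; apply: fibre; [exact: set_mem (valP (h _))..|].
  by rewrite -!kE !Hh.
exists k; split=> //.
move=> z A /nbhs_digitP[j Hj].
have Wz : W (\val z) by exact: set_mem (valP z).
have [e e0 He] := cP j _ Wz.
suff nz : nbhs z [set t | digit m (k t) j = digit m (k z) j].
  by apply: (@filterS _ _ _ _ _ _ nz) => t; exact: Hj.
(* A value [s n] within [e / 2] of [t] is within [e] of [z], so the same [n] reads off the digit [j]
   of both. *)
apply/nbhs_subtypeP; exists (e / 2); first by lra.
move=> t zt /=; have Wt : W (\val t) by exact: set_mem (valP t).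
have [e' e'0 He'] := cP j _ Wt.
have [|n] := dW _ (Num.min e' (e / 2)) Wt; first by rewrite lt_min e'0; lra.
rewrite lt_min => /andP[/He' nt nt2]; rewrite !kE -nt; apply: He.
have := metric_triangle (s n) (\val t) (\val z).
by rewrite (metric_sym (\val t) (\val z)); lra.
Qed.

Lemma eventually_limit_periodic_classification x : compact [set: X] ->
  continuous f -> eventually_limit_periodic f x ->
  periodic_or_odometer_points f x.
Proof.
move=> cX cf ELP.
(* Attraction at the arbitrary scale 1 shows that the limit set is nonempty. *)
have [N /(_ N (leqnn N))[y xy _]] := omega_limit_attracts f x 1 cX ltr01.
pose s n := iter n f y.
have LP : limit_periodic s := omega_limit_periodic x y cf ELP xy.
have EQ := limit_periodic_orbit_equicontinuous f y cX cf LP.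
have Ws n : omega_limit f x (s n) by exact: omega_limit_iter.
have dW z e : omega_limit f x z -> 0 < e -> exists n, mdist (s n) z < e.
  exact: omega_limit_minimal.
have clW := closed_omega_limit f x.
have invW := invariant_omega_limit f x cf.
have cW : compact (omega_limit f x) by apply: subclosed_compact clW cX _.
have [M [M0 Mdvd Msep Mdiam]] := separating_sequence s LP EQ.
have Mnd : nondecreasing_seq M.
  by apply/nondecreasing_seqP => j; exact: dvdn_leq.
have [[B MB]|unb] := pselect (exists B, forall j, (M j <= B)%N).
  left; apply: (dense_bounded_periods s M _ B) => // j.
  by rewrite M0 MB.
right; have Mcvg : M j @[j --> \oo] --> \oo.
  apply/cvgnyPge => A; have [J AJ] : exists J, (A <= M J)%N.
    apply: contrapT => nA; apply: unb; exists A => j.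
    by rewrite leqNgt; apply/negP => /ltnW Aj; apply: nA; exists j.
  by exists J => // j /= Jj; apply: leq_trans AJ (Mnd _ _ Jj).
exact: (dense_unbounded_periods s (PeriodicStructure M0 Mnd Mdvd Mcvg)).
Qed.

End Classification.

(** * Transfer to an equicontinuity point *)

Theorem corollary1p1 (R : realType) (X : metricType R)
    (compactX : compact [set: X]) (f : X -> X) (contf : continuous f) (x : X)
    (equi_x : equicontinuous_at f x)
    (clos_x : closure (periodic_or_odometer_points f) x) :
  periodic_or_odometer_points f x.
Proof.
apply: eventually_limit_periodic_classification => // e e0.
have e30 : (0 < e / 3)%R by lra.
have [d d0 Hd] := equi_x _ e30.
have [|a [Aa xa]] := clos_x [set y | (mdist x y < d)%R].
  by apply/nbhs_mdist_ltP; exists d.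
have {d0 Hd xa} xa i : (mdist (iter i f x) (iter i f a) <= e / 3)%R.
  have := Hd a (ltW xa); rewrite -lee_fin; apply: le_trans.
  by apply: ereal_sup_ubound; exists i.
(* The orbits of [a] and [x] stay within [e / 3], so an almost period of [a] at scale [e / 3] serves
   [x] at scale [e]. *)
have [|q [N [q0 HN]]] := coloring_eventually_limit_periodic f a compactX contf
    _ _ e30.
  by move=> r r0; case: Aa => ?;
    [exact: periodic_orbit_coloring|exact: odometer_coloring].
exists q, N; split=> // n k Nn; have := HN n k Nn; have := xa n.
have := xa (n + k * q)%N.
set x1 := iter n f x; set x2 := iter _ f x; set a1 := iter n f a.
set a2 := iter _ f a.
have := metric_triangle x1 a1 x2; have := metric_triangle a1 a2 x2.
by rewrite (metric_sym a2 x2); lra.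
Qed.
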